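(* Let $$f_R(x)=\frac{1}{1+25x^2}.$$ For each integer $n\ge1$, let $I_n^\varepsilon f_R$ be the polynomial of degree at most $n$ interpolating $f_R$ at distinct nodes $$x_j=\cos\left(\frac{j\pi}{n}+\varepsilon_j\right),\quad j=0,\ldots,n,\qquad \max_{0\le j\le n}|\varepsilon_j|\le\sigma_n,$$ where the $\varepsilon_j\in\mathbb{R}$ may depend on $n$ and $\varepsilon_0=\varepsilon_n=0$. Suppose that, for some fixed $\eta$ (independent of $n$), $$n\sigma_n(\log n+1)\le\eta,\qquad 0<\eta<\left(1+\frac2\pi\right)^{-1}.$$ Then, for every $\rho$ with $$1<\rho<\rho_R,\qquad \rho_R=\frac15+\sqrt{1+\frac1{25}},$$ there is a constant $M_\rho$ (independent of $n$) such that, for all $n\ge1$, $$\|f_R-I_n^\varepsilon f_R\|_{L^\infty[-1,1]}\le\left(1+C_\eta\log(en)\right)\frac{2M_\rho}{\rho-1}\rho^{-n},\qquad C_\eta=\frac{1+\frac2\pi}{1-\left(1+\frac2\pi\right)\eta}.$$ Consequently $I_n^\varepsilon f_R\to f_R$ uniformly on $[-1,1]$ as $n\to\infty$.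
   Context: $\log$ denotes the natural logarithm. *)

(* Defs.v *)
From mathcomp Require Import all_boot all_order all_algebra.
From mathcomp Require Import all_classical all_reals all_analysis.

Set Implicit Arguments.
Unset Strict Implicit.
Unset Printing Implicit Defensive.

Import Order.TTheory GRing.Theory Num.Theory.
Import numFieldNormedType.Exports.

Local Open Scope classical_set_scope.
Local Open Scope ring_scope.

Definition runge {R : realType} (x : R) : R := (1 + 25 * x ^+ 2)^-1.

(* Chebyshev-Lobatto points whose angles are shifted by [eps]. *)
Definition perturbed_node {R : realType} (n : nat) (eps : 'I_n.+1 -> R)
    (j : 'I_n.+1) : R :=
  cos (j%:R * pi / n%:R + eps j).

(* [size p <= n.+1] says that the degree of [p] is at most [n].  For pairwise
   distinct nodes exactly one polynomial satisfies this predicate. *)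
Definition is_interpolant {R : realType} (n : nat) (x : 'I_n.+1 -> R)
    (f : R -> R) (p : {poly R}) : Prop :=
  (size p <= n.+1)%N /\ forall j, p.[x j] = f (x j).

(* The essential supremum with respect to Lebesgue measure on [-1, 1]; it is
   extended-real valued. *)
Definition Linfty_seg {R : realType} (f : R -> R) : \bar R :=
  Lnorm (mrestr lebesgue_measure (measurable_itv `[(-1 : R), 1]))
    +oo%E (EFin \o f).

(* Parameter of the Bernstein ellipse through the poles +-i/5 of [runge]. *)
Definition rho_runge {R : realType} : R := 5^-1 + Num.sqrt (1 + 25^-1).

Definition C_pert {R : realType} (eta : R) : R :=
  (1 + 2 / pi) / (1 - (1 + 2 / pi) * eta).

(* Main.v *)
Require Import Defs.
From mathcomp Require Import all_boot all_order all_algebra.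
From mathcomp Require Import all_classical all_reals all_analysis ess_sup_inf.
From mathcomp Require Import ring lra.

Set Implicit Arguments.
Unset Strict Implicit.
Unset Printing Implicit Defensive.

Import Order.TTheory GRing.Theory Num.Theory.
Import numFieldNormedType.Exports.

Local Open Scope classical_set_scope.
Local Open Scope ring_scope.

(** Under x = cos t a polynomial of degree at most n becomes an even
    trigonometric polynomial of degree at most n, and the unperturbed nodes
    become the equispaced grid j pi / n.  Interpolation on this grid with a
    Dirichlet kernel has Lebesgue constant at most (1 + 2 / pi) (1 + log n).
    If such an f is bounded by B at the perturbed nodes, then Bernstein's
    inequality (from M. Riesz's interpolation formula for the derivative)
    bounds it at the unperturbed ones by B + n sigma ||f||; the smallness
    hypothesis absorbs the second term, so that
    ||f|| <= C_eta (1 + log n) B.  Apply this to the difference of the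
    interpolant and a good approximant of the Runge function: the latter is a
    multiple of a Poisson kernel in 2 t with ratio - rho_R ^ -2, and its
    truncated Fourier series at degree n has an error O (rho_R ^ -n). *)

(** * Product formulas and cosine sums over arithmetic progressions *)

Section TrigonometricSums.
Variable R : realType.
Implicit Types (a b t h : R) (f : R -> R) (n m j : nat).

Lemma cos_mul a b : cos a * cos b = (cos (a - b) + cos (a + b)) / 2.
Proof. by rewrite cosB cosD; field. Qed.

Lemma sin_mul a b : sin a * sin b = (cos (a - b) - cos (a + b)) / 2.
Proof. by rewrite cosB cosD; field. Qed.

Lemma cosD2pin j t : cos (t + 2 * j%:R * pi) = cos t.
Proof.
have -> : 2 * j%:R * pi = (pi *+ 2) *+ j :> R.
  by rewrite -(mulr_natr _ j) -(mulr_natr pi 2); ring.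
exact: (periodicn (@cosD2pi R)).
Qed.

Lemma sinD2pin j t : sin (t + 2 * j%:R * pi) = sin t.
Proof.
have -> : 2 * j%:R * pi = (pi *+ 2) *+ j :> R.
  by rewrite -(mulr_natr _ j) -(mulr_natr pi 2); ring.
exact: (periodicn (@sinD2pi R)).
Qed.

Lemma cosDpin j t : cos (t + j%:R * pi) = (-1) ^+ j * cos t.
Proof.
rewrite [j%:R * pi]mulr_natl.
by rewrite (alternatingn (@cosDpi R)).
Qed.

Lemma sinDpin j t : sin (t + j%:R * pi) = (-1) ^+ j * sin t.
Proof.
rewrite [j%:R * pi]mulr_natl.
by rewrite (alternatingn (@sinDpi R)).
Qed.

(** The sum telescopes, because [2 sin h cos x = sin (x + h) - sin (x - h)]. *)
Lemma sum_cos_arith N a h :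
  2 * sin h * \sum_(k < N) cos (a + 2 * h * k%:R) =
  sin (a + 2 * h * N%:R - h) - sin (a - h).
Proof.
elim: N => [|N IHN]; first by rewrite big_ord0 !mulr0 addr0 subrr.
rewrite big_ord_recr /= mulrDr IHN.
set x := a + 2 * h * N%:R.
have -> : a + 2 * h * N.+1%:R - h = x + h by rewrite /x -natr1; ring.
by rewrite (sinD x h) (sinB x h); ring.
Qed.

(** With [2 h = j pi / n] the two sines left by telescoping differ by [j] full turns and cancel;
    [0 < j < 2 n] puts [h] strictly between [0] and [pi], so [sin h] can be divided out. *)
Lemma sum_cos_eq0 n j a : (0 < j < 2 * n)%N ->
  \sum_(k < 2 * n) cos (a + j%:R * (k%:R * pi / n%:R)) = 0.
Proof.
move=> /andP[j0 jn].
have n0 : (0 < n)%N by case: n jn.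
have n0R : 0 < n%:R :> R by rewrite ltr0n.
pose h : R := j%:R * pi / (2 * n%:R).
have sh : sin h != 0.
  rewrite gt_eqF// sin_gt0_pi// divr_gt0 ?mulr_gt0 ?pi_gt0 ?ltr0n//=.
  by rewrite ltr_pdivrMr ?mulr_gt0// mulrC ltr_pM2l ?pi_gt0// -natrM ltr_nat.
have := sum_cos_arith (2 * n) a h.
have -> : a + 2 * h * (2 * n)%:R - h = a - h + 2 * j%:R * pi.
  by rewrite natrM /h; field; rewrite gt_eqF.
rewrite sinD2pin subrr => /eqP; rewrite !mulf_eq0 (negPf sh) pnatr_eq0/=.
move=> /eqP E; rewrite -[RHS]E; apply: eq_bigr => k _; congr cos.
by rewrite /h; field; rewrite gt_eqF.
Qed.

End TrigonometricSums.

(** * Even trigonometric polynomials *)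

Section Bernstein.
Variable R : realType.
Implicit Types (t : R) (f : R -> R) (n m j : nat).

(* Identities that are linear in the polynomial are proved by induction on this
   predicate, hence only for cosines. *)
Inductive even_trig n : (R -> R) -> Prop :=
| EvenTrigCos m : (m <= n)%N -> even_trig n (fun t => cos (m%:R * t))
| EvenTrigAdd f g : even_trig n f -> even_trig n g -> even_trig n (f \+ g)
| EvenTrigScale a f : even_trig n f -> even_trig n (fun t => a * f t).

Lemma even_trig_leq n m f : (n <= m)%N -> even_trig n f -> even_trig m f.
Proof.
move=> nm; elim => [k kn|g h _ Hg _ Hh|a g _ Hg].
- by apply: EvenTrigCos; exact: leq_trans nm.
- exact: EvenTrigAdd.
- exact: EvenTrigScale.
Qed.

Lemma even_trig_cosM n f : even_trig n f -> even_trig n.+1 (fun t => cos t * f t).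
Proof.
elim => [k kn|g h _ Hg _ Hh|a g _ Hg].
- case: k kn => [_|k kn].
    have -> : (fun t => cos t * cos (0%:R * t)) = (fun t => cos (1%:R * t)).
      by apply/funext => t; rewrite mul0r mul1r cos0 mulr1.
    exact: EvenTrigCos.
  have -> : (fun t => cos t * cos (k.+1%:R * t)) =
      (fun t => 2^-1 * (cos (k%:R * t) + cos (k.+2%:R * t))).
    apply/funext => t; rewrite mulrC cos_mul mulrC -[k.+2%:R]natr1 -natr1.
    by congr (_ * (cos _ + cos _)); ring.
  by apply/EvenTrigScale/(@EvenTrigAdd _ (fun t => cos (k%:R * t))
    (fun t => cos (k.+2%:R * t))); apply: EvenTrigCos => //; do 2!apply: ltnW.
- have -> : (fun t => cos t * (g \+ h) t) =
      (fun t => cos t * g t) \+ (fun t => cos t * h t).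
    by apply/funext => t /=; rewrite mulrDr.
  exact: EvenTrigAdd.
- have -> : (fun t => cos t * (a * g t)) = (fun t => a * (cos t * g t)).
    by apply/funext => t; rewrite mulrCA.
  exact: EvenTrigScale.
Qed.

Lemma even_trig_horner n (p : {poly R}) : (size p <= n.+1)%N ->
  even_trig n (fun t => p.[cos t]).
Proof.
have cosX i : even_trig i (fun t => cos t ^+ i).
  elim: i => [|i /even_trig_cosM IH].
    have -> : (fun t => cos t ^+ 0) = (fun t => cos (0%:R * t)).
      by apply/funext => t; rewrite expr0 mul0r cos0.
    exact: EvenTrigCos.
  suff -> : (fun t => cos t ^+ i.+1) = (fun t => cos t * cos t ^+ i) by [].
  by apply/funext => t; rewrite exprS.
move=> sp.
have -> : (fun t => p.[cos t]) = (fun t => \sum_(i < n.+1) p`_i * cos t ^+ i).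
  by apply/funext => t; rewrite (horner_coef_wide _ sp).
(* The number of summands varies in the induction while the degree bound stays [n]. *)
have : (n.+1 <= n.+1)%N by [].
elim: {-2}n.+1 => [_|k IH kn].
  have -> : (fun t => \sum_(i < 0) p`_i * cos t ^+ i) =
      (fun t => 0 * cos (0%:R * t)).
    by apply/funext => t; rewrite big_ord0 mul0r.
  exact/EvenTrigScale/EvenTrigCos.
have -> : (fun t => \sum_(i < k.+1) p`_i * cos t ^+ i) =
    (fun t => \sum_(i < k) p`_i * cos t ^+ i) \+ (fun t => p`_k * cos t ^+ k).
  by apply/funext => t; rewrite big_ord_recr.
apply: EvenTrigAdd; first exact/IH/ltnW.
by apply/EvenTrigScale/(@even_trig_leq k).
Qed.

End Bernstein.

(** * M. Riesz's interpolation formula and Bernstein's inequality *)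

Section Riesz.
Variable R : realType.
Variable n : nat.
Hypothesis n0 : (0 < n)%N.
Implicit Types (t : R) (f : R -> R) (k m j : nat).

Let n0R : 0 < n%:R :> R. Proof. by rewrite ltr0n. Qed.
Let nN0 : n%:R != 0 :> R. Proof. by rewrite gt_eqF. Qed.

(** For [k < 2 n] these are the zeros of [cos (n t)] on one period. *)
Definition riesz_node k : R := (2 * k%:R + 1) * pi / (2 * n%:R).

(* The sign [(-1) ^+ k] of Riesz's weights is written as a sine so that the
   product-to-sum formulas apply. *)
Definition riesz_weight k : R :=
  sin (n%:R * riesz_node k) / (4 * n%:R * sin (riesz_node k / 2) ^+ 2).

Lemma riesz_nodeE k :
  riesz_node k = pi / (2 * n%:R) + k%:R * pi / n%:R.
Proof. by rewrite /riesz_node; field. Qed.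

Lemma n_riesz_node k : n%:R * riesz_node k = pi / 2 + k%:R * pi.
Proof. by rewrite /riesz_node; field. Qed.

Lemma sin_n_riesz_node k : sin (n%:R * riesz_node k) = (-1) ^+ k.
Proof. by rewrite n_riesz_node sinDpin sin_pihalf mulr1. Qed.

Lemma cos_n_riesz_node k : cos (n%:R * riesz_node k) = 0.
Proof. by rewrite n_riesz_node cosDpin cos_pihalf mulr0. Qed.

Lemma sin_half_riesz_node k : (k < 2 * n)%N -> 0 < sin (riesz_node k / 2).
Proof.
move=> kn; apply: sin_gt0_pi; rewrite /riesz_node; apply/andP; split.
  have k0 : 0 < 2 * k%:R + 1 :> R by rewrite ltr_wpDl// mulr_ge0.
  by rewrite !divr_gt0 ?mulr_gt0 ?pi_gt0.
rewrite -mulrA -invfM ltr_pdivrMr ?mulr_gt0// mulrC ltr_pM2l ?pi_gt0//.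
have : k%:R + 1 <= 2 * n%:R :> R by rewrite natr1 -natrM ler_nat.
by lra.
Qed.

Lemma riesz_node_rev (i : 'I_(2 * n)) :
  riesz_node (rev_ord i) = - riesz_node i + 2 * 1%:R * pi.
Proof.
rewrite /= /riesz_node natrB ?natrM -?natr1; last exact: ltn_ord.
by field.
Qed.

Lemma riesz_weight_rev (i : 'I_(2 * n)) :
  riesz_weight (rev_ord i) = - riesz_weight i.
Proof.
rewrite /riesz_weight riesz_node_rev.
have -> : n%:R * (- riesz_node i + 2 * 1%:R * pi) =
  - (n%:R * riesz_node i) + 2 * n%:R * pi by ring.
rewrite sinD2pin sinN.
have -> : (- riesz_node i + 2 * 1%:R * pi) / 2 = - (riesz_node i / 2) + pi.
  by field.
by rewrite sinDpi sinN opprK mulNr.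
Qed.

(** Reversing the order of the nodes is the reflection [t -> 2 pi - t]; the weights are odd and the
    cosines even under it, so the sum is its own opposite. *)
Lemma sum_riesz_cos j :
  \sum_(k < 2 * n) riesz_weight k * cos (j%:R * riesz_node k) = 0.
Proof.
set S := LHS; suff : S = - S by move=> SN; lra.
rewrite {1}/S (reindex_inj rev_ord_inj)/= -sumrN; apply: eq_bigr => k _.
rewrite riesz_weight_rev riesz_node_rev.
have -> : j%:R * (- riesz_node k + 2 * 1%:R * pi) =
  - (j%:R * riesz_node k) + 2 * j%:R * pi by ring.
by rewrite cosD2pin cosN mulNr.
Qed.

Let B j : R := \sum_(k < 2 * n) riesz_weight k * sin (j%:R * riesz_node k).

(** The identity [sin (u + 2 v) + sin (u - 2 v) - 2 sin u = - 4 sin^2 v sin u], with [v] half a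
    node, cancels the denominator of the weight and leaves a sum that orthogonality evaluates. *)
Lemma riesz_sin_diff2 j : B j.+2 + B j - 2 * B j.+1 =
  - n%:R^-1 * \sum_(k < 2 * n)
    sin (n%:R * riesz_node k) * sin (j.+1%:R * riesz_node k).
Proof.
rewrite /B -big_split/= mulr_sumr -sumrB mulr_sumr; apply: eq_bigr => k _.
have s0 : sin (riesz_node k / 2) != 0 by rewrite gt_eqF// sin_half_riesz_node.
rewrite /riesz_weight.
set u := j.+1%:R * _; set v := riesz_node k / 2 in s0 *.
have vE : riesz_node k = v *+ 2 by rewrite /v mulr2n; field.
have -> : j.+2%:R * riesz_node k = u + v *+ 2.
  by rewrite -vE /u -[j.+2%:R]natr1; ring.
have -> : j%:R * riesz_node k = u - v *+ 2.
  by rewrite -vE /u -[j.+1%:R]natr1; ring.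
rewrite (sinD u (v *+ 2)) (sinB u (v *+ 2)) cos_mulr2n.
by rewrite !mulr2n (cos2sin2 v); field; rewrite s0 nN0.
Qed.

Lemma sum_cos_riesz_node j : (0 < j < 2 * n)%N ->
  \sum_(k < 2 * n) cos (j%:R * riesz_node k) = 0.
Proof.
move=> /(sum_cos_eq0 (j%:R * (pi / (2 * n%:R)))) E; rewrite -[RHS]E.
by apply: eq_bigr => k _; rewrite riesz_nodeE mulrDr.
Qed.

Lemma sum_sin_riesz_node j : (0 < j < n)%N ->
  \sum_(k < 2 * n) sin (n%:R * riesz_node k) * sin (j%:R * riesz_node k) = 0.
Proof.
move=> /andP[j0 jn].
transitivity (2^-1 * (\sum_(k < 2 * n) cos ((n - j)%:R * riesz_node k) -
                      \sum_(k < 2 * n) cos ((n + j)%:R * riesz_node k))).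
  rewrite -sumrB mulr_sumr; apply: eq_bigr => k _.
  by rewrite sin_mul mulrC natrB ?natrD ?(ltnW jn)// mulrBl mulrDl.
rewrite !sum_cos_riesz_node ?subrr ?mulr0//.
  by rewrite addn_gt0 j0 orbT mul2n -addnn ltn_add2l.
by rewrite subn_gt0 jn mul2n -addnn (leq_ltn_trans (leq_subr _ _))// -addn1 leq_add2l.
Qed.

Lemma sum_sin2_riesz_node :
  \sum_(k < 2 * n) sin (n%:R * riesz_node k) * sin (n%:R * riesz_node k)
  = 2 * n%:R.
Proof.
under eq_bigr do rewrite sin_n_riesz_node -expr2 sqrr_sign.
by rewrite sumr_const card_ord -natrM.
Qed.

(** The second differences of [B] centred at [1, ..., n - 1] vanish and [B 0 = 0], so [B j = j B 1]
    up to [n]. The slope comes from the second difference centred at [n]: it equals [- 2], and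
    [B (n + 1) = B (n - 1)] because [cos (n t)] vanishes at the nodes. *)
Lemma sum_riesz_sin j : (j <= n)%N ->
  \sum_(k < 2 * n) riesz_weight k * sin (j%:R * riesz_node k) = j%:R.
Proof.
rewrite -/(B j).
have B0 : B 0 = 0.
  by rewrite /B big1// => k _; rewrite mul0r sin0 mulr0.
have Blin : forall j, (j <= n)%N -> B j = j%:R * B 1.
  suff H j' : (j' < n)%N -> B j' = j'%:R * B 1 /\ B j'.+1 = j'.+1%:R * B 1.
    by case=> [|i] ni; [rewrite B0 mul0r|have [] := H i ni].
  elim: j' => [_|i IHi ni]; first by rewrite B0 mul0r mul1r.
  have [IH1 IH2] := IHi (ltnW ni); split=> //.
  have := riesz_sin_diff2 i; rewrite sum_sin_riesz_node//= mulr0 => /eqP.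
  rewrite IH1 IH2 => /eqP E; rewrite -[i.+2%:R]natr1 -[i.+1%:R]natr1.
  rewrite -[i.+1%:R]natr1 in E; lra.
suff B1 : B 1 = 1 by move=> /Blin->; rewrite B1 mulr1.
have := riesz_sin_diff2 n.-1; rewrite prednK//.
have -> : B n.+1 = B n.-1.
  rewrite /B; apply: eq_bigr => k _; congr (_ * _).
  have -> : n.+1%:R * riesz_node k = n%:R * riesz_node k + riesz_node k.
    by rewrite -natr1; ring.
  have -> : n.-1%:R * riesz_node k = n%:R * riesz_node k - riesz_node k.
    have -> : n%:R = n.-1%:R + 1 :> R by rewrite natr1 prednK.
    by ring.
  by rewrite sinD sinB cos_n_riesz_node !mul0r addr0 subr0.
rewrite sum_sin2_riesz_node (Blin n)// (Blin n.-1) ?leq_pred//.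
have -> : n%:R = n.-1%:R + 1 :> R by rewrite natr1 prednK.
have -> : - (n.-1%:R + 1)^-1 * (2 * (n.-1%:R + 1)) = -2 :> R.
  by field; rewrite natr1 prednK.
lra.
Qed.

(** M. Riesz's formula. For [cos (m t)], the addition formula separates [t] from the nodes, and the
    two weighted sums are [0] and [m]. *)
Lemma is_derive_even_trig f t : even_trig n f ->
  is_derive t 1 f (\sum_(k < 2 * n) riesz_weight k * f (t + riesz_node k)).
Proof.
elim => [m mn|g h _ Hg _ Hh|a g _ Hg].
- have E : \sum_(k < 2 * n) riesz_weight k * cos (m%:R * (t + riesz_node k)) =
      - (m%:R * sin (m%:R * t)).
    transitivity (cos (m%:R * t) * (\sum_(k < 2 * n)
          riesz_weight k * cos (m%:R * riesz_node k)) -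
        sin (m%:R * t) * (\sum_(k < 2 * n)
          riesz_weight k * sin (m%:R * riesz_node k))).
      rewrite !mulr_sumr -sumrB; apply: eq_bigr => k _.
      by rewrite mulrDr cosD; ring.
    by rewrite sum_riesz_cos sum_riesz_sin// mulr0 sub0r mulrC.
  have lin : is_derive t 1 (fun u : R => m%:R * u) m%:R.
    have := is_deriveZ m%:R (is_derive_id t (1 : R)).
    by rewrite /GRing.scale/= mulr1.
  have := is_derive1_comp (is_derive_cos (m%:R * t)) lin.
  by rewrite E mulNr mulrC.
- have -> : \sum_(k < 2 * n) riesz_weight k * (g \+ h) (t + riesz_node k) =
      \sum_(k < 2 * n) riesz_weight k * g (t + riesz_node k) +
      \sum_(k < 2 * n) riesz_weight k * h (t + riesz_node k).
    by rewrite -big_split/=; apply: eq_bigr => k _; rewrite mulrDr.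
  exact: is_deriveD.
- have -> : \sum_(k < 2 * n) riesz_weight k * (a * g (t + riesz_node k)) =
      a *: (\sum_(k < 2 * n) riesz_weight k * g (t + riesz_node k)).
    by rewrite /GRing.scale/= mulr_sumr; apply: eq_bigr => k _; ring.
  exact: is_deriveZ.
Qed.

(** The sign of a weight is the value of [sin (n t)] at its node, so the sum of absolute values is
    the sine sum of frequency [n]. *)
Lemma sum_norm_riesz_weight : \sum_(k < 2 * n) `|riesz_weight k| = n%:R.
Proof.
rewrite -[RHS](sum_riesz_sin (leqnn n)); apply: eq_bigr => k _.
rewrite /riesz_weight sin_n_riesz_node normrM normr_sign mul1r.
rewrite gtr0_norm ?invr_gt0 ?mulr_gt0 ?exprn_gt0 ?sin_half_riesz_node//.
by rewrite [RHS]mulrAC -expr2 sqrr_sign mul1r.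
Qed.

(** Riesz's formula bounds the derivative by [n S]; the mean value theorem turns this into the
    Lipschitz form used for shifted nodes. *)
Lemma bernstein f (S s t : R) : even_trig n f -> (forall u, `|f u| <= S) ->
  `|f t - f s| <= n%:R * S * `|t - s|.
Proof.
move=> fn fS.
wlog st : s t / s <= t.
  move=> H; have [|/ltW] := leP s t; first exact: H.
  by rewrite distrC [`|t - s|]distrC; exact: H.
have [|c _ ->] := MVT_segment st (fun x _ => is_derive_even_trig x fn).
  apply: derivable_within_continuous => x _.
  by have [] := is_derive_even_trig x fn.
rewrite normrM ler_wpM2r//; apply: (le_trans (ler_norm_sum _ _ _)).
rewrite -sum_norm_riesz_weight mulr_suml; apply: ler_sum => k _.
by rewrite normrM ler_wpM2l.
Qed.

End Riesz.

(** * Interpolation on the equispaced grid and its Lebesgue constant *)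

Section LebesgueConstant.
Variable R : realType.
Variable n : nat.
Hypothesis n0 : (0 < n)%N.
Implicit Types (t u : R) (f : R -> R) (a k m j : nat).

Let n0R : 0 < n%:R :> R. Proof. by rewrite ltr0n. Qed.
Let nN0 : n%:R != 0 :> R. Proof. by rewrite gt_eqF. Qed.

(* The frequencies [n] and [- n], which coincide on a grid of [2 * n] points,
   get half the weight that they have in the usual Dirichlet kernel. *)
Definition dirichlet u : R :=
  1 + 2 * \sum_(1 <= i < n) cos (i%:R * u) + cos (n%:R * u).

(** The closed form [sin (n u) cot (u / 2)] of the modified kernel, with the denominator cleared. *)
Lemma dirichlet_sin u :
  dirichlet u * sin (u / 2) = sin (n%:R * u) * cos (u / 2).
Proof.
rewrite /dirichlet; case: n n0 => // N _; rewrite big_add1/=.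
elim: N => [|N IH].
  rewrite big_geq// mulr0 addr0 !mul1r; set v := u / 2.
  have -> : u = v *+ 2 by rewrite /v mulr2n; field.
  by rewrite cos_mulr2n sin_mulr2n !mulr2n; ring.
rewrite big_nat_recr//=.
set S := \sum_(_ <= _ < _) _ in IH *.
have -> : N.+2%:R * u = N.+1%:R * u + (u / 2) *+ 2.
  by rewrite mulr2n -[N.+2%:R]natr1; field.
set x := N.+1%:R * u in IH *.
rewrite (cosD x) (sinD x) cos_mulr2n sin_mulr2n.
have -> : (1 + 2 * (S + cos x) + (cos x * (cos (u / 2) ^+ 2 *+ 2 - 1) -
    sin x * (cos (u / 2) * sin (u / 2) *+ 2))) * sin (u / 2) =
    (1 + 2 * S + cos x) * sin (u / 2) + (cos x * (cos (u / 2) ^+ 2 *+ 2) -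
    sin x * (cos (u / 2) * sin (u / 2) *+ 2)) * sin (u / 2).
  by ring.
rewrite IH !mulr2n.
have -> : sin x * cos (u / 2) = sin x * cos (u / 2) * (cos (u/2)^+2 + sin (u/2)^+2).
  by rewrite cos2Dsin2 mulr1.
have -> : cos (u / 2) ^+ 2 + cos (u / 2) ^+ 2 - 1 =
    cos (u / 2) ^+ 2 - sin (u / 2) ^+ 2 by rewrite sin2cos2; ring.
by ring.
Qed.

Lemma norm_dirichlet u : `|dirichlet u| <= 2 * n%:R.
Proof.
rewrite /dirichlet; apply: (le_trans (ler_normD _ _)).
apply: (le_trans (lerD (ler_normD _ _) (cos_max _))).
rewrite normr1 normrM ger0_norm//.
suff : `|\sum_(1 <= i < n) cos (i%:R * u)| <= n%:R - 1 by lra.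
apply: (le_trans (ler_norm_sum _ _ _)).
apply: (@le_trans _ _ (\sum_(1 <= i < n) (1 : R))).
  by apply: ler_sum => i _; exact: cos_max.
by rewrite sumr_const_nat natrB.
Qed.

(** By the mean value theorem [sin v = v cos c] with [c <= v], and cosine decreases on [[0, pi]]. *)
Lemma mul_cos_le_sin (v : R) : 0 <= v <= pi -> v * cos v <= sin v.
Proof.
move=> /andP[v0 vpi].
have [|c /itvP cv] := MVT_segment v0 (fun x _ => is_derive_sin x).
  exact/continuous_subspaceT/continuous_sin.
rewrite sin0 !subr0 => ->; rewrite mulrC ler_wpM2r//.
have [->//|cNv] := eqVneq c v.
apply/ltW; rewrite ltr_cos ?in_itv/= ?v0 ?vpi ?cv ?(le_trans _ vpi) ?cv//.
by rewrite lt_neqAle cNv cv.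
Qed.

(** The closed form gives at most [cot (u / 2) <= 2 / u] for [u > 0], and [u] is at least [i] grid
    steps. *)
Lemma norm_dirichlet_far u (i : nat) : (0 < i)%N ->
  i%:R * pi / n%:R <= `|u| <= pi -> `|dirichlet u| <= 2 * n%:R / (pi * i%:R).
Proof.
move=> i0; wlog u0 : u / 0 <= u.
  move=> H; have [|/ltW u0] := leP 0 u; first exact: H.
  have -> : dirichlet u = dirichlet (- u).
    rewrite /dirichlet mulrN cosN; congr (_ + 2 * _ + _).
    by apply: eq_bigr => j _; rewrite mulrN cosN.
  by rewrite -normrN; apply: H; rewrite oppr_ge0.
rewrite (ger0_norm u0) => /andP[iu upi].
have i0R : 0 < i%:R :> R by rewrite ltr0n.
have pi0 := @pi_gt0 R.
have u_gt0 : 0 < u by apply: lt_le_trans iu; rewrite divr_gt0 ?mulr_gt0.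
have s0 : 0 < sin (u / 2) by apply: sin_gt0_pi; lra.
have c0 : 0 <= cos (u / 2) by apply: cos_ge0_pihalf; lra.
have key : u / 2 * cos (u / 2) <= sin (u / 2) by apply: mul_cos_le_sin; lra.
have Du : `|dirichlet u| * u <= 2.
  rewrite -(ler_pM2r s0) mulrAC -{1}(gtr0_norm s0) -normrM dirichlet_sin.
  rewrite normrM (ger0_norm c0) -mulrA.
  apply: (@le_trans _ _ (1 * (cos (u / 2) * u))).
    by rewrite ler_wpM2r ?sin_max// mulr_ge0// ltW.
  lra.
apply: (@le_trans _ _ (2 / u)); first by rewrite ler_pdivlMr.
rewrite ler_pdivrMr// mulrAC ler_pdivlMr ?mulr_gt0//.
move: iu; rewrite ler_pdivrMr//; lra.
Qed.

(** Discrete orthogonality of cosines on any [2 n] consecutive grid points. The offset [a] is free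
    so that the window can later be centred at [t]. *)
Lemma even_trig_interp a f t : even_trig n f ->
  f t = (2 * n%:R)^-1 * \sum_(k < 2 * n)
    f ((a%:R + k%:R) * pi / n%:R) * dirichlet (t - (a%:R + k%:R) * pi / n%:R).
Proof.
have node k : (a%:R + k%:R) * pi / n%:R =
    a%:R * pi / n%:R + k%:R * pi / n%:R :> R by field.
have sumE m (b : R) : (0 < m < 2 * n)%N ->
    \sum_(k < 2 * n) cos (b + m%:R * ((a%:R + k%:R) * pi / n%:R)) = 0.
  move=> /(sum_cos_eq0 (b + m%:R * (a%:R * pi / n%:R))) E; rewrite -[RHS]E.
  by apply: eq_bigr => k _; rewrite node (mulrDr m%:R) addrA.
have sumN m (b : R) : (0 < m < 2 * n)%N ->
    \sum_(k < 2 * n) cos (b - m%:R * ((a%:R + k%:R) * pi / n%:R)) = 0.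
  move=> /(sumE m (- b)) E; rewrite -[RHS]E.
  by apply: eq_bigr => k _; rewrite -cosN opprB addrC.
(* The sum frequency averages out, the difference frequency only if [m != i]. The excluded pairs
   [m = i = 0] and [m = i = n] are treated separately. *)
have orth m i : (m <= n)%N -> (i <= n)%N -> (0 < m + i < 2 * n)%N ->
    \sum_(k < 2 * n) cos (m%:R * ((a%:R + k%:R) * pi / n%:R)) *
      cos (i%:R * (t - (a%:R + k%:R) * pi / n%:R)) =
    if m == i then n%:R * cos (m%:R * t) else 0.
  move=> mn iN mi.
  transitivity (2^-1 *
      (\sum_(k < 2 * n) cos (i%:R * t + m%:R * ((a%:R + k%:R) * pi / n%:R)
          - i%:R * ((a%:R + k%:R) * pi / n%:R)) +
       \sum_(k < 2 * n) cos (i%:R * t -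
          (m + i)%:R * ((a%:R + k%:R) * pi / n%:R)))).
    rewrite -big_split/= mulr_sumr; apply: eq_bigr => k _.
    rewrite mulrC cos_mul mulrC addrC; congr (_ * (cos _ + cos _)).
      by ring.
    by ring.
  rewrite sumN// addr0; have [->|neq_mi] := eqVneq m i.
    under eq_bigr do rewrite addrK.
    by rewrite sumr_const card_ord -[_ *+ (2 * n)]mulr_natl natrM; field.
  have [lt_im|le_mi] := ltnP i m.
    rewrite -[X in _ * X](_ : 0 = _) ?mulr0//.
    rewrite -[LHS](sumE (m - i)%N (i%:R * t)).
      by apply: eq_bigr => k _; rewrite natrB 1?ltnW// mulrBl addrA.
    rewrite subn_gt0 lt_im (leq_ltn_trans (leq_subr _ _))//.
    by rewrite (leq_ltn_trans mn)// ltn_Pmull.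
  have lt_mi : (m < i)%N by rewrite ltn_neqAle neq_mi.
  rewrite -[X in _ * X](_ : 0 = _) ?mulr0//.
  rewrite -[LHS](sumN (i - m)%N (i%:R * t)).
    by apply: eq_bigr => k _; rewrite natrB// mulrBl opprB addrA.
  rewrite subn_gt0 lt_mi (leq_ltn_trans (leq_subr _ _))//.
  by rewrite (leq_ltn_trans iN)// ltn_Pmull.
elim => [m mn|g h _ Hg _ Hh|c g _ Hg].
- rewrite /dirichlet.
  transitivity ((2 * n%:R)^-1 * (
      \sum_(k < 2 * n) cos (m%:R * ((a%:R + k%:R) * pi / n%:R)) +
      2 * \sum_(1 <= i < n) \sum_(k < 2 * n)
        cos (m%:R * ((a%:R + k%:R) * pi / n%:R)) *
        cos (i%:R * (t - (a%:R + k%:R) * pi / n%:R)) +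
      \sum_(k < 2 * n) cos (m%:R * ((a%:R + k%:R) * pi / n%:R)) *
        cos (n%:R * (t - (a%:R + k%:R) * pi / n%:R)))); last first.
    congr (_ * _); rewrite exchange_big/= mulr_sumr -!big_split/=.
    by apply: eq_bigr => k _; rewrite -mulr_sumr; ring.
  have n2 : (n < 2 * n)%N by rewrite ltn_Pmull.
  have mid : \sum_(1 <= i < n) \sum_(k < 2 * n)
      cos (m%:R * ((a%:R + k%:R) * pi / n%:R)) *
      cos (i%:R * (t - (a%:R + k%:R) * pi / n%:R)) =
      if (0 < m < n)%N then n%:R * cos (m%:R * t) else 0.
    transitivity (\sum_(1 <= i < n | i == m) (n%:R * cos (m%:R * t))).
      rewrite [RHS]big_mkcond; apply: eq_big_nat => i /andP[i0 iN].
      rewrite orth ?(ltnW iN) 1?eq_sym ?addn_gt0 ?i0 ?orbT//=.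
      by rewrite mul2n -addnn -addnS leq_add.
    rewrite big_mkcond -big_mkcond/= big_nat1_eq.
    by [].
  rewrite mid; case: m mn mid orth => [|m] mn _ orth /=.
    have -> : \sum_(k < 2 * n) cos (0%:R * ((a%:R + k%:R) * pi / n%:R)) = 2 * n%:R :> R.
      under eq_bigr do rewrite mul0r cos0.
      by rewrite sumr_const card_ord natrM.
    rewrite orth ?add0n ?n0//= eq_sym (gtn_eqF n0) mulr0 !addr0 mul0r cos0.
    by rewrite mulVf// mulf_neq0.
  have s0 : \sum_(k < 2 * n) cos (m.+1%:R * ((a%:R + k%:R) * pi / n%:R)) = 0 :> R.
    under eq_bigr do rewrite -[X in cos X]add0r.
    by apply: sumE; rewrite /= (leq_ltn_trans mn).
  rewrite s0; have [mn'|nm] := ltnP m.+1 n.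
    rewrite orth//; last by rewrite mul2n -addnn ltn_add2r.
    by rewrite (ltn_eqF mn') addr0 add0r; field.
  (* At the top frequency both factors carry the sign [(-1)^(a + k)], so every product equals
     [cos (n t)]. *)
  have -> : m.+1 = n by apply/eqP; rewrite eqn_leq mn nm.
  rewrite mulr0 !add0r.
  transitivity ((2 * n%:R)^-1 * \sum_(k < 2 * n) cos (n%:R * t)).
    by rewrite sumr_const card_ord -[_ *+ (2 * n)]mulr_natl natrM; field.
  congr (_ * _); apply: eq_bigr => k _.
  have -> : n%:R * ((a%:R + k%:R) * pi / n%:R) = 0 + (a + k)%:R * pi :> R.
    by rewrite natrD; field.
  have -> : cos (n%:R * (t - (a%:R + k%:R) * pi / n%:R)) =
      cos (- (n%:R * t) + (a + k)%:R * pi).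
    by rewrite -cosN natrD; congr cos; field.
  by rewrite !cosDpin cosN cos0 mulr1 mulrA -expr2 sqrr_sign mul1r.
- rewrite /= {1}Hg {1}Hh -mulrDr -big_split/=; congr (_ * _).
  by apply: eq_bigr => k _; rewrite (mulrDl (g _)).
- rewrite {1}Hg mulrCA mulr_sumr; congr (_ * _).
  by apply: eq_bigr => k _; rewrite mulrA.
Qed.

Lemma even_trigN f t : even_trig n f -> f (- t) = f t.
Proof.
elim => [m _|g h _ Hg _ Hh|c g _ Hg] /=; first by rewrite mulrN cosN.
- by rewrite Hg Hh.
- by rewrite Hg.
Qed.

Lemma even_trigD2pi f t : even_trig n f -> f (t + 2 * pi) = f t.
Proof.
elim => [m _|g h _ Hg _ Hh|c g _ Hg] /=.
- by rewrite -[RHS](cosD2pin m); congr cos; ring.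
- by rewrite Hg Hh.
- by rewrite Hg.
Qed.

(** Periodicity and evenness fold the whole grid onto its points in [[0, pi]]. *)
Lemma even_trig_grid f (S : R) : even_trig n f ->
  (forall j, (j <= n)%N -> `|f (j%:R * pi / n%:R)| <= S) ->
  forall k, `|f (k%:R * pi / n%:R)| <= S.
Proof.
move=> fn fS k; elim/ltn_ind: k => k IH.
have [|nk] := leqP k n; first exact: fS.
have [kn2|n2k] := leqP k (2 * n).
  have <- : f ((2 * n - k)%:R * pi / n%:R) = f (k%:R * pi / n%:R).
    rewrite -(even_trigN (k%:R * pi / n%:R) fn) -[RHS](even_trigD2pi _ fn).
    by congr f; rewrite natrB// natrM; field.
  by apply: fS; rewrite leq_subLR mul2n -addnn leq_add2r ltnW.
have <- : f ((k - 2 * n)%:R * pi / n%:R) = f (k%:R * pi / n%:R).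
  rewrite -[LHS](even_trigD2pi _ fn).
  by congr f; rewrite natrB 1?ltnW// natrM; field.
by apply: IH; rewrite ltn_subrL muln_gt0/= n0 (leq_trans _ nk).
Qed.

(** Take [n] grid points on each side of [t]. On either side the point of rank [i] is between [i]
    grid steps and [pi] away, so the kernel there is at most [2 n] for [i = 0] and [2 n / (pi i)]
    otherwise. *)
Lemma even_trig_norm_harmonic f (S : R) t : even_trig n f ->
  (forall j, (j <= n)%N -> `|f (j%:R * pi / n%:R)| <= S) ->
  `|f t| <= (2 + 2 / pi * \sum_(1 <= i < n) i%:R^-1) * S.
Proof.
move=> fn fS.
wlog t0 : t / 0 <= t.
  move=> H; have [|/ltW t0] := leP 0 t; first exact: H.
  by rewrite -(even_trigN _ fn); apply: H; rewrite oppr_ge0.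
have pi0 := @pi_gt0 R.
have piN0 : pi != 0 :> R by rewrite gt_eqF.
have S0 : 0 <= S by apply: le_trans (fS 0%N _).
(* Adding a period makes the integer part [N] at least [n], so that the first index [N - (n - 1)] of
   the window is not truncated. *)
rewrite -(even_trigD2pi _ fn); set t' := t + 2 * pi.
pose x := t' * n%:R / pi.
have t'0 : 0 <= t' by rewrite /t'; lra.
have x0 : 0 <= x by rewrite divr_ge0 ?mulr_ge0 ?pi_ge0.
have /andP[Nx xN] := truncn_itv x0; set N := Num.truncn x in Nx xN.
have nN : (n <= N)%N.
  rewrite /N truncn_ge_nat// /x ler_pdivlMr// mulrC ler_wpM2r//.
  by rewrite /t'; lra.
pose a := (N - n.-1)%N.
have aE : a%:R = N%:R - n%:R + 1 :> R.
  rewrite /a natrB; last exact: leq_trans (leq_pred _) nN.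
  have -> : n%:R = n.-1%:R + 1 :> R by rewrite natr1 prednK.
  by ring.
have uE k : t' - (a%:R + k%:R) * pi / n%:R =
    (x - N%:R + n%:R - 1 - k%:R) * pi / n%:R.
  by rewrite aE /x; move: (pi) piN0 => p pN0; field; rewrite nN0 pN0.
rewrite (even_trig_interp a t' fn) normrM ger0_norm ?invr_ge0 ?mulr_ge0//.
pose G i : R := if i is 0%N then 2 * n%:R else 2 * n%:R / (pi * i%:R).
have GD i u : i%:R * pi / n%:R <= `|u| <= pi -> `|dirichlet u| <= G i.
  by case: i => [_|i]; [exact: norm_dirichlet|exact: norm_dirichlet_far].
have sumG : \sum_(0 <= i < n) G i =
    2 * n%:R + 2 * n%:R / pi * \sum_(1 <= i < n) i%:R^-1.
  rewrite big_ltn//; congr (_ + _); rewrite mulr_sumr.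
  by apply: eq_big_nat => -[//|i] _; rewrite /G invfM mulrA.
have bound : \sum_(k < 2 * n) `|dirichlet (t' - (a%:R + k%:R) * pi / n%:R)| <=
    2 * \sum_(0 <= i < n) G i.
  rewrite -(big_mkord xpredT (fun k =>
    `|dirichlet (t' - (a%:R + k%:R) * pi / n%:R)|)).
  rewrite (@big_cat_nat _ _ _ n)//=; last by rewrite mul2n -addnn leq_addr.
  rewrite mulr2n mulrDl mul1r; apply: lerD.
    (* Reversing the left half makes [i] count outwards from [t]. *)
    rewrite big_nat_rev/= add0n big_nat [leRHS]big_nat.
    apply: ler_sum => i /andP[_ iN]; apply: GD; rewrite uE natrB// -natr1.
    have -> : x - N%:R + n%:R - 1 - (n%:R - (i%:R + 1)) = x - N%:R + i%:R.
      by ring.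
    have Nx0 : 0 <= x - N%:R by rewrite subr_ge0.
    have i0 : 0 <= i%:R :> R by [].
    rewrite ger0_norm; last by rewrite divr_ge0 ?mulr_ge0 ?pi_ge0//; lra.
    rewrite !ler_pM2r ?invr_gt0//; apply/andP; split; first lra.
    rewrite ler_pdivrMr// mulrC ler_pM2l//.
    have : i%:R + 1 <= n%:R :> R by rewrite natr1 ler_nat.
    move: xN; rewrite -natr1; lra.
  rewrite -{1}[n]add0n mul2n -addnn big_addn addnK big_nat [leRHS]big_nat.
  apply: ler_sum => i /andP[_ iN]; apply: GD; rewrite uE natrD.
  have -> : x - N%:R + n%:R - 1 - (i%:R + n%:R) = - (i%:R + (N%:R + 1 - x)).
    by ring.
  have Nx0 : 0 <= N%:R + 1 - x by rewrite subr_ge0 natr1 ltW.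
  have i0 : 0 <= i%:R :> R by [].
  rewrite !mulNr normrN ger0_norm; last first.
    by rewrite divr_ge0 ?mulr_ge0 ?pi_ge0//; lra.
  rewrite !ler_pM2r ?invr_gt0//; apply/andP; split; first lra.
  rewrite ler_pdivrMr// mulrC ler_pM2l//.
  have : i%:R + 1 <= n%:R :> R by rewrite natr1 ler_nat.
  lra.
have -> : (2 + 2 / pi * \sum_(1 <= i < n) i%:R^-1) * S =
    (2 * n%:R)^-1 * (2 * (\sum_(0 <= i < n) G i) * S).
  by rewrite sumG; move: (pi) piN0 => p pN0; field; rewrite nN0 pN0.
rewrite ler_wpM2l ?invr_ge0 ?mulr_ge0//.
apply: (le_trans (ler_norm_sum _ _ _)).
apply: (@le_trans _ _ ((\sum_(k < 2 * n)
    `|dirichlet (t' - (a%:R + k%:R) * pi / n%:R)|) * S)); last first.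
  by rewrite ler_wpM2r.
rewrite mulr_suml; apply: ler_sum => k _.
by rewrite normrM mulrC ler_wpM2l// -natrD; exact: even_trig_grid.
Qed.

End LebesgueConstant.

(** * Logarithmic bounds and stability under perturbed nodes *)

Section LogarithmicBound.
Variable R : realType.
Implicit Types (f : R -> R) (S t eta B : R) (n : nat).

(** Since [ln (24 / 23) >= 1 / 24], it suffices that the 16th power of [24 / 23] is at most [2]. *)
Lemma ln2_ge : 2 / 3 <= ln 2 :> R.
Proof.
have step : 24^-1 <= - ln (1 - 24^-1) :> R.
  by rewrite lerNr le_ln1Dx// ltrNr opprK invf_lt1// ltr1n.
have pos : 0 < 24 / 23 :> R by rewrite divr_gt0.
have : ln ((24 / 23) ^+ 16) <= ln 2 :> R.
  rewrite ler_ln ?posrE ?exprn_gt0//.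
  rewrite (_ : (24 / 23) ^+ 16 = ((((24 / 23) ^+ 2) ^+ 2) ^+ 2) ^+ 2 :> R); last first.
    by rewrite -!exprM.
  have sq (x y z : R) : 0 <= x -> x <= y -> y * y <= z -> x ^+ 2 <= z.
    by move=> x0 xy; apply: le_trans; rewrite expr2 ler_pM.
  have s0 x : 0 <= x ^+ 2 :> R by exact: sqr_ge0.
  (* The intermediate powers are rounded up to [49 / 45], [593 / 500] and [141 / 100], which keeps
     the fractions small. *)
  apply: (sq _ (141 / 100)) => //; last by lra.
  apply: (sq _ (593 / 500)) => //; last by lra.
  apply: (sq _ (49 / 45)) => //; last by lra.
  by apply: (sq _ (24 / 23)); [exact: ltW|exact: lexx|lra].
apply: le_trans; rewrite lnXn//.
have -> : 24 / 23 = (1 - 24^-1)^-1 :> R by field.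
rewrite lnV ?posrE; last by rewrite subr_gt0 invf_lt1// ltr1n.
by move: step; set l := ln _; rewrite -mulr_natr; lra.
Qed.

Lemma harmonic_ln n : (2 <= n)%N ->
  2 + 2 / pi * \sum_(1 <= i < n) i%:R^-1 <= (1 + 2 / pi) * (1 + ln n%:R) :> R.
Proof.
set c : R := 2 / pi.
have pi0 := @pi_gt0 R.
have c0 : 2^-1 <= c by rewrite ler_pdivlMr//; have := @pihalf_lt2 R; lra.
have c1 : c <= 1 by rewrite ler_pdivrMr// mul1r; exact: pi_ge2.
elim: n => [//|n IH]; rewrite leq_eqVlt => /predU1P[<-|].
  (* For [n = 2] the claim is [1 <= (1 + c) ln 2]; the bounds [1 / 2] and [2 / 3] give exactly
     this. *)
  rewrite big_nat1 invr1; have := ln2_ge; nra.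
rewrite ltnS => n2; rewrite big_nat_recr 1?ltnW//= mulrDr addrA.
have n0 : 0 < n%:R :> R by rewrite ltr0n; exact: ltn_trans n2.
have n1 : 1 <= n%:R :> R by rewrite ler1n ltnW.
have lnS : (n%:R + 1)^-1 <= ln (n.+1%:R) - ln n%:R :> R.
  rewrite -ln_div ?posrE ?ltr0n ?(ltn_trans _ n2)// -natr1.
  have -> : (n%:R + 1) / n%:R = (1 - (n%:R + 1)^-1)^-1 :> R.
    by field; do ?[apply/andP; split]; apply: lt0r_neq0; lra.
  have i1 : (n%:R + 1)^-1 < 1 :> R by rewrite invf_lt1 ?ltrDr ?addr_gt0.
  rewrite lnV ?posrE ?subr_gt0// lerNr le_ln1Dx//.
  by rewrite ltrNr opprK.
apply: (le_trans (lerD (IH n2) (lexx _))).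
(* Clearing denominators leaves [c <= n]. *)
suff : c * n%:R^-1 <= (1 + c) * (n%:R + 1)^-1 by nra.
rewrite ler_pdivrMr// mulrAC ler_pdivlMr ?addr_gt0//; nra.
Qed.

Lemma even_trig_norm_ln n f S t : (0 < n)%N -> even_trig n f ->
  (forall j, (j <= n)%N -> `|f (j%:R * pi / n%:R)| <= S) ->
  `|f t| <= (1 + 2 / pi) * (1 + ln n%:R) * S.
Proof.
move=> n0 fn fS; have S0 : 0 <= S by apply: le_trans (fS 0%N _).
have pi0 := @pi_gt0 R.
have c0 : 0 <= 2 / pi :> R by rewrite divr_ge0 ?pi_ge0.
(* For [n = 1] the kernel is nonnegative, hence the Lebesgue constant is [1]. *)
have [n1|] := leqP n 1; last first.
  move=> n2; apply: (le_trans (even_trig_norm_harmonic n0 t fn fS)).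
  by rewrite ler_wpM2r// harmonic_ln.
have {n0 n1} n1 : n = 1%N by apply/eqP; rewrite eqn_leq n1.
move: fn fS; rewrite n1 => fn fS.
rewrite ln1 addr0 mulr1.
suff : `|f t| <= S by move/le_trans; apply; rewrite ler_peMl// lerDl.
have D1 u : dirichlet 1 u = 1 + cos u :> R.
  by rewrite /dirichlet big_geq// mulr0 addr0 mul1r.
rewrite (even_trig_interp (ltn0Sn 0) 0 t fn) muln1 mulr1.
rewrite !big_ord_recl big_ord0 addr0 !D1 /= !add0r mul0r mul0r subr0 invr1 mulr1.
rewrite mul1r cosB cospi sinpi mulr0 !addr0 mulrN1.
have f0 : `|f 0| <= S by have := fS 0%N isT; rewrite !mul0r.
have fpi : `|f pi| <= S by have := fS 1%N isT; rewrite mul1r invr1 mulr1.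
have /andP[cN cP] : -1 <= cos t <= 1 by rewrite cos_geN1 cos_le1.
rewrite normrM gtr0_norm ?invr_gt0// mulrC ler_pdivrMr//.
apply: (le_trans (ler_normD _ _)); rewrite !normrM.
rewrite (ger0_norm (_ : 0 <= 1 + cos t)); last by lra.
rewrite (ger0_norm (_ : 0 <= 1 - cos t)); last by lra.
nra.
Qed.

(** With [m] the maximum at the unperturbed nodes, Bernstein's inequality gives [m <= B + c eta m].
    Solving for [m] produces the denominator of [C_pert]. *)
Lemma even_trig_norm_perturbed n f (eps : 'I_n.+1 -> R) (sigma : R) eta B t :
  (0 < n)%N -> even_trig n f ->
  (forall j : 'I_n.+1, `|eps j| <= sigma) ->
  n%:R * sigma * (ln n%:R + 1) <= eta -> (1 + 2 / pi) * eta < 1 ->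
  (forall j : 'I_n.+1, `|f (j%:R * pi / n%:R + eps j)| <= B) ->
  `|f t| <= C_pert eta * (1 + ln n%:R) * B.
Proof.
move=> n0 fn eps_sigma small eta1 fB.
have pi0 := @pi_gt0 R.
set c := 1 + 2 / pi in eta1 *.
have c0 : 0 < c by rewrite ltr_wpDr// divr_ge0 ?pi_ge0.
set L := 1 + ln n%:R.
have L0 : 0 <= L by rewrite addr_ge0// ln_ge0// ler1n.
pose m := \big[Num.max/0]_(j < n.+1) `|f (j%:R * pi / n%:R)|.
have m0 : 0 <= m by rewrite /m; elim/big_rec: _ => // i x _ x0; rewrite le_max x0 orbT.
have fm j : (j <= n)%N -> `|f (j%:R * pi / n%:R)| <= m.
  by rewrite -ltnS => jn; rewrite /m (bigD1 (Ordinal jn))//= le_max lexx.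
have fc u : `|f u| <= c * L * m by exact: even_trig_norm_ln.
have B0 : 0 <= B by apply: le_trans (fB ord0).
have mB : m <= B + c * eta * m.
  rewrite {1}/m; elim/big_ind: _ => [|x y xB yB|j _].
  (* The default [0] of the maximum requires [0 <= eta], which the smallness hypothesis implies. *)
  - have : 0 <= sigma by apply: le_trans (eps_sigma ord0).
    move=> s0; rewrite addr_ge0// !mulr_ge0// ?(ltW c0)//.
    by apply: le_trans small; rewrite !mulr_ge0// addrC.
  - by rewrite ge_max xB yB.
  rewrite -(subrK (f (j%:R * pi / n%:R + eps j)) (f (j%:R * pi / n%:R))) addrC.
  apply: (le_trans (ler_normD _ _)); apply: lerD; first exact: fB.
  apply: (le_trans (bernstein n0 _ _ fn fc)).
  rewrite opprD addNKr normrN.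
  apply: (@le_trans _ _ (n%:R * (c * L * m) * sigma)).
    by rewrite ler_wpM2l// !mulr_ge0// ltW.
  have -> : n%:R * (c * L * m) * sigma = c * (n%:R * sigma * (ln n%:R + 1)) * m.
    by rewrite /L; ring.
  by rewrite ler_wpM2r// ler_wpM2l// ltW.
have d0 : 0 < 1 - c * eta by rewrite subr_gt0.
have mB' : m <= B / (1 - c * eta) by rewrite ler_pdivlMr//; lra.
apply: (le_trans (fc t)).
have -> : C_pert eta * L * B = c * L * (B / (1 - c * eta)).
  by rewrite /C_pert -/c; field; rewrite gt_eqF.
by rewrite ler_wpM2l// mulr_ge0// ltW.
Qed.

End LogarithmicBound.

(** * Geometric approximation of the Runge function *)

Section RungeApproximation.
Variable R : realType.
Implicit Types (s t u : R) (n m k : nat).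

Definition poisson_sum s m u : R := 1 + 2 * \sum_(k < m) s ^+ k.+1 * cos (k.+1%:R * u).

(* The Poisson kernel [(1 - s ^+ 2) / (1 - 2 * s * cos u + s ^+ 2)] minus its
   partial Fourier sum, with the denominator cleared. *)
Lemma poisson_sum_remainder s m u :
  1 - s ^+ 2 - (1 - 2 * s * cos u + s ^+ 2) * poisson_sum s m u =
  2 * s ^+ m.+1 * (cos (m.+1%:R * u) - s * cos (m%:R * u)).
Proof.
rewrite /poisson_sum; elim: m => [|m IH].
  by rewrite big_ord0 mul0r mul1r cos0; ring.
rewrite big_ord_recr/=; move: IH.
set W := 1 - 2 * s * cos u + s ^+ 2; set S := \sum_(_ < _) _ => IH.
set c := s ^+ m.+1 * _.
have -> : 1 - s ^+ 2 - W * (1 + 2 * (S + c)) =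
  1 - s ^+ 2 - W * (1 + 2 * S) - W * (2 * c) by ring.
rewrite IH /c /W.
have -> : m.+2%:R * u = m.+1%:R * u + u by rewrite -[m.+2%:R]natr1; ring.
have -> : m%:R * u = m.+1%:R * u - u by rewrite -[m.+1%:R]natr1; ring.
set v := m.+1%:R * u.
by rewrite (cosD v u) (cosB v u) !exprS; ring.
Qed.

Lemma even_trig_poisson_sum s m n : (2 * m <= n)%N ->
  even_trig n (fun t => poisson_sum s m (2 * t)).
Proof.
elim: m => [_|m IH mn].
  suff -> : (fun t => poisson_sum s 0 (2 * t)) = (fun t => cos (0%:R * t)).
    exact: EvenTrigCos.
  by apply/funext => t; rewrite /poisson_sum big_ord0 mulr0 addr0 mul0r cos0.
have -> : (fun t => poisson_sum s m.+1 (2 * t)) =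
    (fun t => poisson_sum s m (2 * t)) \+
    (fun t => (2 * s ^+ m.+1) * cos ((2 * m.+1)%:R * t)).
  apply/funext => t; rewrite /poisson_sum big_ord_recr/= mulrDr addrA -mulrA.
  by congr (_ + _ * (_ * cos _)); rewrite natrM; ring.
apply: EvenTrigAdd; last exact/EvenTrigScale/EvenTrigCos.
by apply: IH; apply: leq_trans mn; rewrite leq_mul2l/=.
Qed.

Lemma rho_runge_gt1 : 1 < rho_runge :> R.
Proof.
rewrite /rho_runge; have : 1 <= Num.sqrt (1 + 25^-1) :> R.
  by rewrite -{1}sqrtr1 ler_wsqrtr// lerDl.
by lra.
Qed.

(** Equivalently [(rho - 1 / rho) / 2 = 1 / 5]: the minor semi-axis of the ellipse reaches the
    poles. *)
Lemma rho_runge_sqr : rho_runge ^+ 2 = 1 + 2 / 5 * rho_runge :> R.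
Proof.
rewrite /rho_runge; set w := Num.sqrt _.
have w2 : w ^+ 2 = 1 + 25^-1 by rewrite sqr_sqrtr// addr_ge0.
have -> : (5^-1 + w) ^+ 2 = 25^-1 + 2 / 5 * w + w ^+ 2 by field.
by rewrite w2; field.
Qed.

(** For [s = - q^2] the Poisson denominator in [2 t] is [(4 / 25) q^2 (1 + 25 cos^2 t)], so
    [runge (cos t)] is [kappa] times the Poisson kernel, and truncation leaves an explicit
    remainder. *)
Lemma runge_approx : exists2 K : R, 0 <= K & forall n,
  exists2 g : R -> R, even_trig n g &
    forall t, `|runge (cos t) - g t| <= K * rho_runge ^- n.
Proof.
set q : R := rho_runge^-1.
have rho1 := rho_runge_gt1; have rho0 : 0 < rho_runge :> R by apply: lt_trans rho1.
have q0 : 0 < q by rewrite invr_gt0.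
have q1 : q < 1 by rewrite invf_lt1.
have qE : 1 - q ^+ 2 = 2 / 5 * q.
  have rN0 : rho_runge != 0 :> R by rewrite gt_eqF.
  apply: (mulIf (expf_neq0 2 rN0)); rewrite mulrBl /q -exprMn mulVf// expr1n.
  rewrite mul1r [X in X - _ = _]rho_runge_sqr; move: rN0; move: (rho_runge) => r rN0.
  by rewrite expr2 mulrA mulfVK//; ring.
have q2 : 0 <= q ^+ 2 < 1 by rewrite sqr_ge0 exprn_ilt1// ltW.
have q4 : 0 < 1 - q ^+ 4 by rewrite subr_gt0 exprn_ilt1// ltW.
(* The remainder has a factor [2] and a difference of cosines of size at most [2]; the denominator
   [W] is at least [1]. *)
exists (4 / (1 - q ^+ 4)); first by rewrite divr_ge0// ltW.
move=> n; pose m := n./2; pose s := - q ^+ 2.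
pose kappa := 4 / 25 * q ^+ 2 / (1 - q ^+ 4).
exists (fun t => kappa * poisson_sum s m (2 * t)).
  by apply/EvenTrigScale/even_trig_poisson_sum; rewrite mul2n -geq_half_double.
move=> t; pose W := 1 + 25 * cos t ^+ 2.
have W1 : 1 <= W by rewrite lerDl mulr_ge0 ?sqr_ge0.
have WE : 1 - 2 * s * cos (2 * t) + s ^+ 2 = 4 / 25 * q ^+ 2 * W.
  have -> : 2 * t = t *+ 2 by rewrite mulr2n; ring.
  rewrite cos_mulr2n /s /W.
  have -> : 1 - 2 * - q ^+ 2 * (cos t ^+ 2 *+ 2 - 1) + (- q ^+ 2) ^+ 2 =
    (1 - q ^+ 2) ^+ 2 + 4 * q ^+ 2 * cos t ^+ 2 by rewrite mulr2n; ring.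
  by rewrite qE; field.
have := poisson_sum_remainder s m (2 * t); rewrite WE => rem.
have qN0 : q != 0 by rewrite gt_eqF.
have -> : runge (cos t) - kappa * poisson_sum s m (2 * t) =
    (1 - q ^+ 4)^-1 * (2 * s ^+ m.+1 *
      (cos (m.+1%:R * (2 * t)) - s * cos (m%:R * (2 * t)))) / W.
  rewrite -rem /runge -/W /kappa /s; field.
  by rewrite !gt_eqF//; apply: lt_le_trans W1.
(* The choice of [m] as half of [n] keeps [2 m <= n] for the degree and gives [2 (m + 1) >= n] for
   the error. *)
have sn : `|s ^+ m.+1| <= rho_runge ^- n.
  rewrite normrX /s normrN ger0_norm ?sqr_ge0// -exprM -exprVn -/q.
  apply: ler_wiXn2l => //; [exact: ltW|exact: ltW|].
  rewrite mul2n doubleS /m -{1}(odd_double_half n).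
  by case: (odd n) => //; rewrite leqW.
rewrite !normrM gtr0_norm ?invr_gt0// [`|2|]ger0_norm//.
rewrite [4 / _]mulrC -!mulrA ler_pM2l ?invr_gt0//.
have V1 : `|W^-1| <= 1.
  by rewrite gtr0_norm ?invf_le1 ?invr_gt0//; apply: lt_le_trans W1.
have c2 : `|cos (m.+1%:R * (2 * t)) - s * cos (m%:R * (2 * t))| <= 2.
  apply: (le_trans (ler_normB _ _)); rewrite normrM.
  apply: (@le_trans _ _ (1 + 1 * 1)); last by rewrite mulr1.
  rewrite lerD ?cos_max// ler_pM ?cos_max//.
  by rewrite /s normrN ger0_norm; case/andP: q2 => // _ /ltW.
rewrite (_ : 4 = 2 * 2); last by ring.
rewrite -mulrA ler_pM2l// mulrA.
rewrite -mulrA [2 / _]mulrC; apply: ler_pM => //.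
by apply: (le_trans (ler_pM _ _ c2 V1)) => //; rewrite mulr1.
Qed.

End RungeApproximation.

(** * Essential supremum, uniform convergence and a null sequence *)

Section UniformNorms.
Variable R : realType.
Implicit Types (f g : R -> R) (b q : R) (n : nat).

Lemma Linfty_seg_le f b : 0 <= b -> (forall x, -1 <= x <= 1 -> `|f x| <= b) ->
  (Linfty_seg f <= b%:E)%E.
Proof.
move=> b0 fb; rewrite /Linfty_seg unlock /=.
(* The norm is [0] by convention on a space of total measure zero; [0 <= b] covers that branch. *)
case: ifP => _; last by rewrite lee_fin.
apply/ess_supP; exists (~` `[(-1 : R), 1]); split.
- by apply: measurableC; exact: measurable_itv.
- by rewrite /= /mrestr setICl measure0.
- move=> x /= H /=; apply: contra_not H => x1.
  by rewrite lee_fin; apply: fb; move: x1; rewrite in_itv.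
Qed.

Lemma cvg_uniform_seg (u : nat -> R -> R) f (b : nat -> R) :
  b @ \oo --> 0 ->
  (forall n x, (1 <= n)%N -> -1 <= x <= 1 -> `|f x - u n x| <= b n) ->
  {uniform `[(-1 : R), 1], u @ \oo --> f}.
Proof.
move=> /cvgrPdist_lt b0 fu P /uniform_nbhs[E [entE EP]].
have [e /= e0 eE] : exists2 e : R, 0 < e & forall x y : R, `|x - y| < e -> E (x, y).
  move: (entE); rewrite -entourage_from_ballE => -[e /= e0 eE].
  by exists e => // x y xy; apply: eE; rewrite /= -ball_normE.
near=> n; apply: EP => x; rewrite /= in_itv/= => x1; apply: eE.
apply: le_lt_trans (fu n x _ x1) _; first by near: n; exists 1%N.
have : `|0 - b n| < e by near: n; exact: b0.
by rewrite sub0r normrN; apply: le_lt_trans; exact: ler_norm.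
Unshelve. all: by end_near. Qed.

(** With [r = sqrt q], one factor [r^n] absorbs [n] and the other tends to [0]. *)
Lemma cvg_mul_geometric q : 0 < q < 1 -> (fun n => n%:R * q ^+ n) @ \oo --> (0 : R).
Proof.
move=> /andP[q0 q1]; pose r := Num.sqrt q.
have r0 : 0 < r by rewrite sqrtr_gt0.
have r1 : r < 1 by rewrite -sqrtr1 ltr_sqrt.
have rq : r ^+ 2 = q by rewrite sqr_sqrtr// ltW.
have d0 : 0 < 1 - r by rewrite subr_gt0.
have geo : (fun n => (1 - r)^-1 * r ^+ n) @ \oo --> (0 : R).
  by apply: cvg_geometric; rewrite gtr0_norm.
have bern n : n%:R * r ^+ n <= (1 - r)^-1.
  rewrite -[leRHS]mul1r ler_pdivlMr//.
  (* That is, [n r^n <= 1 + r + ... + r^(n - 1)], where every term is at least [r^n]. *)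
  suff : n%:R * r ^+ n * (1 - r) <= 1 - r ^+ n.
    by have := exprn_ge0 n (ltW r0); lra.
  elim: n => [|n IH]; first by rewrite !mul0r expr0 subrr.
  rewrite exprS -natr1; set z := r ^+ n in IH *.
  have z1 : r * z <= 1.
    by rewrite mulr_ile1 ?exprn_ge0 ?exprn_ile1 ?(ltW r0) ?(ltW r1).
  nra.
apply: (squeeze_cvgr _ (cvg_cst (0 : R)) geo).
apply: nearW => n; rewrite mulr_ge0 ?exprn_ge0 ?(ltW q0)//=.
by rewrite -rq -exprM mul2n -addnn exprD mulrA ler_wpM2r ?exprn_ge0// ltW.
Qed.

End UniformNorms.

(** * Interpolation error and the final estimate *)

Lemma interp_error (R : realType) (f : R -> R) n (g : R -> R)
    (eps : 'I_n.+1 -> R) (sigma eta E x : R) (p : {poly R}) :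
  (0 < n)%N -> even_trig n g -> (forall t, `|f (cos t) - g t| <= E) ->
  (forall j : 'I_n.+1, `|eps j| <= sigma) ->
  is_interpolant (perturbed_node eps) f p ->
  n%:R * sigma * (ln n%:R + 1) <= eta -> (1 + 2 / pi) * eta < 1 ->
  -1 <= x <= 1 -> `|f x - p.[x]| <= (1 + C_pert eta * (1 + ln n%:R)) * E.
Proof.
move=> n0 gn fg eps_sigma [sp px] small eta1 x1.
have pg : even_trig n ((fun t => p.[cos t]) \+ (fun t => -1 * g t)).
  exact: EvenTrigAdd (even_trig_horner sp) (EvenTrigScale _ gn).
have xE : x = cos (acos x) by rewrite acosK// in_itv.
(* At the perturbed nodes [p] agrees with [f], so [p - g] is bounded there by [E] and the stability
   estimate applies to it. *)
have -> : f x - p.[x] = (f (cos (acos x)) - g (acos x)) -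
    (p.[cos (acos x)] + -1 * g (acos x)) by rewrite -xE; ring.
rewrite mulrDl mul1r; apply: (le_trans (ler_normB _ _)); apply: lerD => //.
apply: (even_trig_norm_perturbed _ n0 pg eps_sigma small eta1) => j /=.
by have := px j; rewrite /perturbed_node => ->; rewrite mulN1r.
Qed.

Theorem corollary4p2 (R : realType) :
  exists M : R -> R,
  forall (eta : R) (sigma : nat -> R) (eps : forall n : nat, 'I_n.+1 -> R)
      (I : nat -> {poly R}),
    (forall n : nat, (1 <= n)%N ->
       [/\ eps n ord0 = 0, eps n ord_max = 0 &
           \big[Num.max/0]_(j < n.+1) `|eps n j| <= sigma n]) ->
    (forall n : nat, (1 <= n)%N -> injective (perturbed_node (eps n))) ->
    (forall n : nat, (1 <= n)%N ->
       is_interpolant (perturbed_node (eps n)) runge (I n)) ->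
    0 < eta < (1 + 2 / pi)^-1 ->
    (forall n : nat, (1 <= n)%N ->
       n%:R * sigma n * (ln n%:R + 1) <= eta) ->
    (forall rho : R, 1 < rho < rho_runge ->
       forall n : nat, (1 <= n)%N ->
         (Linfty_seg (fun x => runge x - (I n).[x])%R
          <= ((1 + C_pert eta * ln (expR 1 * n%:R))
              * (2 * M rho / (rho - 1)) * rho ^- n)%R%:E)%E) /\
    {uniform `[(-1 : R), 1], (fun (n : nat) (x : R) => (I n).[x]) @ \oo
       --> (runge : R -> R)}.
Proof.
have [K K0 approx] := runge_approx R.
(* This choice makes [2 M / (rho - 1)] equal to [K]; the error decays like [rho_runge ^- n], which
   is at most [rho ^- n]. *)
exists (fun rho => K * (rho - 1) / 2).
move=> eta sigma eps I eps_sigma _ interp /andP[eta0 eta_lt] small.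
have c0 : 0 < 1 + 2 / pi :> R by rewrite ltr_wpDr// divr_ge0 ?pi_ge0.
have eta1 : (1 + 2 / pi) * eta < 1 by rewrite mulrC -ltr_pdivlMr// div1r.
set C := C_pert eta.
have C0 : 0 <= C by apply: divr_ge0; [exact: ltW|rewrite subr_ge0 ltW].
have lnE n : (1 <= n)%N -> ln (expR 1 * n%:R) = 1 + ln n%:R :> R.
  by move=> n1; rewrite lnM ?posrE ?expR_gt0 ?ltr0n// expRK.
have ln0 n : (1 <= n)%N -> 0 <= ln n%:R :> R.
  by move=> n1; rewrite ln_ge0// ler1n.
have rhoR1 := rho_runge_gt1 R.
have rhoR0 : 0 < rho_runge :> R by exact: lt_trans rhoR1.
have err n x : (1 <= n)%N -> -1 <= x <= 1 ->
    `|runge x - (I n).[x]| <= (1 + C * (1 + ln n%:R)) * (K * rho_runge ^- n).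
  move=> n1 x1; have [g gn fg] := approx n.
  apply: (interp_error n1 gn fg _ (interp n n1) (small n n1) eta1 x1) => j.
  have [_ _] := eps_sigma n n1; apply: le_trans.
  by rewrite (bigD1 j)//= le_max lexx.
split=> [rho /andP[rho1 rho_lt] n n1|].
  rewrite lnE//.
  have -> : 2 * (K * (rho - 1) / 2) / (rho - 1) = K.
    by field; rewrite subr_eq0 gt_eqF.
  have D0 : 0 <= 1 + C * (1 + ln n%:R).
    by rewrite addr_ge0// mulr_ge0// addr_ge0// ln0.
  have rho0 : 0 < rho by exact: lt_trans rho1.
  apply: Linfty_seg_le => [|x x1].
    by rewrite !mulr_ge0// invr_ge0 exprn_ge0// ltW.
  apply: (le_trans (err n x n1 x1)); rewrite -mulrA ler_wpM2l// ler_wpM2l//.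
  by rewrite lef_pV2 ?posrE ?exprn_gt0// lerXn2r ?nnegrE// ltW.
(* For convergence the cruder bound [1 + ln n <= n] replaces the logarithmic factor by
   [(1 + C) n]. *)
pose b n : R := (1 + C) * K * (n%:R * rho_runge^-1 ^+ n).
apply: (@cvg_uniform_seg _ _ _ b) => [|n x n1 x1].
  rewrite -[X in _ --> X](mulr0 ((1 + C) * K)).
  apply: cvgMr; apply: cvg_mul_geometric.
  by rewrite invr_gt0 rhoR0 invf_lt1.
apply: (le_trans (err n x n1 x1)).
have -> : b n = (1 + C) * n%:R * (K * rho_runge ^- n).
  by rewrite /b exprVn; ring.
rewrite ler_wpM2r//.
  by rewrite mulr_ge0// invr_ge0 exprn_ge0// ltW.
rewrite mulrDl mul1r lerD ?ler1n// ler_wpM2l//.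
suff : ln n%:R <= n%:R - 1 :> R by lra.
have -> : ln n%:R = ln (1 + (n%:R - 1)) :> R by rewrite addrC subrK.
by rewrite le_ln1Dx// ltrBrDr addNr ltr0n.
Qed.
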